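(* Let $n>1$ and $t>2$ be two positive integers. Then $\varphi(K_n\boxdot P_t)$ takes the following values in the following cases (nothing is asserted for other pairs $(n,t)$): \[\varphi(K_n\boxdot P_t)=\begin{cases} n+1, & \text{if either } (n=2 \text{ and } t=3) \text{ or } (n\geq 7 \text{ and } t=3),\\ n+2, & \text{if either } (n=2 \text{ and } t>3), \text{ or } n\in\{3,4\}, \text{ or } n\geq 2t+1>7. \end{cases}\]
   Context: All graphs are finite and simple. $P_n$ and $K_n$ denote respectively the path and the complete graph with $n$ vertices. The subdivision graph $S(G)$ of a graph $G$ is obtained by inserting one new vertex into every edge of $G$. For graphs $G$ and $H$, with $V(G)=\{u_0,\ldots,u_{m-1}\}$, the subdivision-vertex neighbourhood corona (SVN corona) $G\boxdot H$ is the graph obtained from $S(G)$ by adding $m$ vertex-disjoint copies of $H$ (one for each $u_i$) and joining, for each $i$, every vertex of $N_{S(G)}(u_i)$ (the neighbourhood of $u_i$ in $S(G)$) to every vertex of the copy of $H$ associated with $u_i$. A $b$-chromatic coloring of a graph with $k$ colors is a proper coloring with colors $0,\ldots,k-1$ such that, for each color $i$, there is a vertex (a $b$-vertex) of color $i$ having, for each color $j\neq i$, a neighbour of color $j$. The $b$-chromatic number $\varphi(G)$ is the maximum $k$ for which $G$ has a $b$-chromatic coloring with $k$ colors. *)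

(* Defs.v *)
From mathcomp Require Import all_boot.

Set Implicit Arguments.
Unset Strict Implicit.
Unset Printing Implicit Defensive.

Record sgraph := SGraph {
  svertex :> finType;
  adj : rel svertex;
  adj_sym : symmetric adj;
  adj_irrefl : irreflexive adj }.

Definition complete_rel n : rel 'I_n := fun x y => x != y.

Lemma complete_sym n : symmetric (@complete_rel n).
Proof. by move=> x y; rewrite /complete_rel eq_sym. Qed.

Lemma complete_irrefl n : irreflexive (@complete_rel n).
Proof. by move=> x; rewrite /complete_rel eqxx. Qed.

Definition complete_graph n : sgraph :=
  SGraph (@complete_sym n) (@complete_irrefl n).

Definition path_rel t : rel 'I_t :=
  fun x y => (x.+1 == y :> nat) || (y.+1 == x :> nat).

Lemma path_sym t : symmetric (@path_rel t).
Proof. by move=> x y; rewrite /path_rel orbC. Qed.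

Lemma path_irrefl t : irreflexive (@path_rel t).
Proof. by move=> x; rewrite /path_rel orbb eqn_leq ltnn. Qed.

Definition path_graph t : sgraph := SGraph (@path_sym t) (@path_irrefl t).

Section Subdivision.
Variable G : sgraph.

Definition edge_set : {set {set G}} :=
  [set e | [exists x, exists y, adj x y && (e == [set x; y])]].

Definition edge_of : finType := {e : {set G} | e \in edge_set}.

Definition subdivision_rel : rel (G + edge_of) := fun a b =>
  match a, b with
  | inl u, inr e | inr e, inl u => u \in val e
  | _, _ => false
  end.

Lemma subdivision_sym : symmetric subdivision_rel.
Proof. by move=> [u|e] [v|f]. Qed.

Lemma subdivision_irrefl : irreflexive subdivision_rel.
Proof. by case. Qed.

Definition subdivision : sgraph := SGraph subdivision_sym subdivision_irrefl.

End Subdivision.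

Section Corona.
Variables G H : sgraph.

(* [inr (u, h)] is the vertex [h] in the copy of [H] associated with [u]. *)
Definition svn_corona_rel : rel (subdivision G + G * H) := fun a b =>
  match a, b with
  | inl x, inl y => adj x y
  | inl x, inr (u, _) | inr (u, _), inl x => adj (inl u : subdivision G) x
  | inr (u, h), inr (v, k) => (u == v) && adj h k
  end.

Lemma svn_corona_sym : symmetric svn_corona_rel.
Proof.
move=> [x|[u h]] [y|[v k]] //=; first exact: subdivision_sym.
by rewrite eq_sym (adj_sym h).
Qed.

Lemma svn_corona_irrefl : irreflexive svn_corona_rel.
Proof. by move=> [x|[u h]] /=; rewrite ?subdivision_irrefl ?adj_irrefl ?andbF. Qed.

Definition svn_corona : sgraph := SGraph svn_corona_sym svn_corona_irrefl.

End Corona.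

Section BChromatic.
Variable G : sgraph.

Definition proper_coloring k (c : {ffun G -> 'I_k}) : bool :=
  [forall x, forall y, adj x y ==> (c x != c y)].

Definition b_vertex k (c : {ffun G -> 'I_k}) (v : G) : bool :=
  [forall j : 'I_k, (j != c v) ==> [exists w, adj v w && (c w == j)]].

Definition b_coloring k (c : {ffun G -> 'I_k}) : bool :=
  proper_coloring c && [forall i, exists v, (c v == i) && b_vertex c v].

Definition b_colorable k : bool := [exists c : {ffun G -> 'I_k}, b_coloring c].

(* A b-chromatic coloring uses all its colors, so restricting the maximum to
   [k <= #|G|] loses nothing: see [b_colorable_le] and [b_colorable_bchrom]. *)
Definition b_chromatic_number : nat := \max_(k < #|G|.+1 | b_colorable k) k.

Lemma b_colorable_card k : b_colorable k -> k <= #|G|.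
Proof.
case/existsP=> c /andP[_ /forallP hb].
have surj i : i \in codom c.
  by have /existsP[v /andP[/eqP <- _]] := hb i; exact: codom_f.
rewrite -[k]card_ord; apply: leq_trans (leq_image_card c predT).
by apply: subset_leq_card; apply/subsetP=> i _; exact: surj.
Qed.

Lemma b_colorable_le k : b_colorable k -> k <= b_chromatic_number.
Proof.
move=> hk; have lek : k < #|G|.+1 by rewrite ltnS b_colorable_card.
exact: (@leq_bigmax_cond _ (fun k : 'I_#|G|.+1 => b_colorable k)
          (fun k => k : nat) (Ordinal lek)).
Qed.

Lemma b_colorable_bchrom :
  0 < b_chromatic_number -> b_colorable b_chromatic_number.
Proof.
rewrite /b_chromatic_number; elim/big_ind: _ => // m n hm hn.
by rewrite /maxn; case: ifP.
Qed.

End BChromatic.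

(* Main.v *)
Require Import Defs.
From mathcomp Require Import all_boot all_algebra zify.

Set Implicit Arguments.
Unset Strict Implicit.
Unset Printing Implicit Defensive.

(* A b-vertex has degree at least k - 1, which with k = n + 3 colours leaves
   only the edge-vertices, and these are too few (n <= 4) or of too small degree
   2t + 2 (n >= 2t + 1); hence the upper bound n + 2.  For t = 3 and k = n + 2
   the candidates are the n midpoints of the paths and, if n <= 7, the
   edge-vertices.  In the tight case n = 7, if the edge-vertex ij is a b-vertex,
   then the colours other than its own are split evenly between the sets A_i and
   A_j of colours of u_i and its copy, and the midpoints of the copies i and j
   are not b-vertices; a rank argument then bounds the number of b-colours.

   For the lower bounds one colours the edge ij of K_n by v_i + v_j in a cyclic
   group Z_N, so that few colours are missing at each vertex; the copy of the
   path at u_i is coloured with the missing colours, so that its vertices see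
   all the colours. *)

(** * Colourings of the corona in coordinates *)

Section Coordinates.
Variables n t k : nat.

Section Nbrs.
Variables (cu : 'I_n -> 'I_k) (ce : 'I_n -> 'I_n -> 'I_k).
Variable cp : 'I_n -> 'I_t -> 'I_k.

(** The colours of u_i, of the edge-vertex ij and of the vertices of the copy at u_i are [cu i],
    [ce i j] and [cp i h]; [ce i i] is a junk value. Neighbour colours are kept as lists, whose
    sizes are the degrees. *)
Definition vertex_nbrs i := [seq ce i j | j <- enum (predC1 i)].
Definition copy_nbrs i h :=
  vertex_nbrs i ++ [seq cp i h' | h' <- enum (path_rel h)].
Definition edge_nbrs i j := cu i :: cu j :: codom (cp i) ++ codom (cp j).

Definition proper_coords : Prop :=
  [/\ forall i j, ce i j = ce j i,
      forall i j, i != j -> cu i != ce i j,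
      forall i j h, i != j -> cp i h != ce i j
    & forall i h h', path_rel h h' -> cp i h != cp i h'].

Definition b_coords (x : 'I_k) : Prop :=
  [\/ exists2 i, cu i = x & {subset predC1 x <= vertex_nbrs i},
      exists i h, cp i h = x /\ {subset predC1 x <= copy_nbrs i h}
    | exists i j, [/\ i != j, ce i j = x & {subset predC1 x <= edge_nbrs i j}]].

End Nbrs.

Let K := complete_graph n.
Let G := svn_corona K (path_graph t).

Lemma mem_edge_set (i j : K) : i != j -> [set i; j] \in edge_set K.
Proof.
by move=> ij; rewrite inE; apply/existsP; exists i; apply/existsP; exists j;
  rewrite eqxx andbT.
Qed.

Lemma edge_ofP (e : edge_of K) :
  exists2 p : 'I_n * 'I_n, p.1 != p.2 & val e = [set p.1; p.2].
Proof.
case: e => /= e; rewrite inE => /existsP[i /existsP[j /andP[ij /eqP->]]].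
by exists (i, j).
Qed.

Lemma edge_of_at (e : edge_of K) (i : 'I_n) :
  i \in val e -> exists2 j, j != i & val e = [set i; j].
Proof.
have [[a b] /= ab ->] := edge_ofP e.
rewrite !inE => /orP[]/eqP->; first by exists b; rewrite // eq_sym.
by exists a => //; rewrite setUC.
Qed.

Lemma coords_of_b_coloring : b_colorable G k ->
  exists cu ce cp, @proper_coords cu ce cp /\ forall x, @b_coords cu ce cp x.
Proof.
case/existsP=> c /andP[/forallP properc /forallP bc].
pose cu (i : 'I_n) := c (inl (inl i)).
(* For i = j the set [[set i; j]] is no edge and [cu i] is an arbitrary default. *)
pose ce (i j : 'I_n) :=
  if insub [set i; j] is Some e then c (inl (inr e)) else cu i.
pose cp (i : 'I_n) (h : 'I_t) := c (inr (i, h)).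
have proper (x y : G) : adj x y -> c x != c y.
  by move=> xy; have /forallP/(_ y)/implyP := properc x; apply.
have ceE (e : edge_of K) (i j : 'I_n) :
    val e = [set i; j] -> ce i j = c (inl (inr e)).
  by move=> eij; rewrite /ce -eij valK.
have ceX (i j : 'I_n) : i != j ->
    exists2 e : edge_of K, val e = [set i; j] & ce i j = c (inl (inr e)).
  move=> ij; pose e : edge_of K := Sub [set i; j] (mem_edge_set ij).
  by exists e => //; apply: ceE.
exists cu, ce, cp; split; first split.
- move=> i j; have [->//|/ceX[e eij ->]] := eqVneq i j.
  by rewrite (ceE e) // eij setUC.
- move=> i j /ceX[e eij ->]; apply: proper => /=.
  by rewrite eij !inE eqxx.
- move=> i j h /ceX[e eij ->]; apply: proper => /=.
  by rewrite eij !inE eqxx.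
- by move=> i h h' hh'; apply: proper => /=; rewrite eqxx.
move=> x; have /existsP[v /andP[/eqP vx /forallP bv]] := bc x.
have {}bv y : y != x -> exists2 w, adj v w & c w = y.
  move=> yx; have := bv y; rewrite vx yx => /existsP[w /andP[vw /eqP]].
  by exists w.
case: v vx bv => [[i|e]|[i h]] vx bv.
- constructor 1; exists i => // y /bv[[[j|e]|[j h]]] //= ie <-.
    have [j ji eij] := edge_of_at ie.
    by apply/mapP; exists j; rewrite ?mem_enum //; rewrite (ceE e).
- have [[i j] /= ij eij] := edge_ofP e.
  constructor 3; exists i, j; split=> //; first by rewrite (ceE e).
  move=> y /bv[[[l|f]|[l h]]] //=; rewrite eij !inE => /orP[]/eqP-> <-;
    rewrite ?eqxx ?orbT // mem_cat.
    by rewrite (codom_f (cp i)) !orbT.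
  by rewrite (codom_f (cp j)) !orbT.
- constructor 2; exists i, h; split=> // y /bv[[[l|e]|[l h']]] //=.
    move=> ie <-; have [j ji eij] := edge_of_at ie.
    rewrite mem_cat; apply/orP; left.
    by apply/mapP; exists j; rewrite ?mem_enum //; rewrite (ceE e).
  case/andP=> /eqP<- hh' <-; rewrite mem_cat; apply/orP; right.
  by apply/mapP; exists h'; rewrite ?mem_enum.
Qed.

Lemma b_colorable_of_coords cu ce cp :
  @proper_coords cu ce cp -> (forall x, @b_coords cu ce cp x) ->
  b_colorable G k.
Proof.
case=> ceC cuP ceP cpP bx.
have edgeX (e : edge_of K) : exists p : 'I_n * 'I_n,
    (p.1 != p.2) && (val e == [set p.1; p.2]).
  by have [p p12 /eqP ep] := edge_ofP e; exists p; rewrite p12.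
(* The orientation of the edge is chosen arbitrarily; [colE] removes the choice by the symmetry of
   [ce]. *)
pose col (e : edge_of K) := let p := xchoose (edgeX e) in ce p.1 p.2.
pose c : {ffun G -> 'I_k} := [ffun v : G => match v with
  | inl (inl i) => cu i | inl (inr e) => col e | inr (i, h) => cp i h end].
have colE (e : edge_of K) (i j : 'I_n) :
    i != j -> val e = [set i; j] -> col e = ce i j.
  move=> ij eij; rewrite /col; case: (xchoose _) (xchooseP (edgeX e)) => a b /=.
  rewrite eij => /andP[ab /eqP/setP E].
  have := E i; have := E j; rewrite !inE !eqxx /= orbT.
  case/esym/orP=> /eqP ja /esym/orP[]/eqP ia; subst.
  - by rewrite eqxx in ij.
  - exact: ceC.
  - by [].
  - by rewrite eqxx in ij.
have colX (i j : 'I_n) : i != j ->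
    exists2 e : edge_of K, val e = [set i; j] & col e = ce i j.
  move=> ij; pose e : edge_of K := Sub [set i; j] (mem_edge_set ij).
  by exists e => //; apply: colE.
have colP (e : edge_of K) (i : 'I_n) :
    i \in val e -> exists2 j, i != j & col e = ce i j.
  move=> /edge_of_at[j ji eij]; exists j; first by rewrite eq_sym.
  by rewrite (colE e i j) // eq_sym.
apply/existsP; exists c; apply/andP; split.
  apply/forallP=> -[[i|e]|[i h]]; apply/forallP=> -[[j|f]|[j h']];
    apply/implyP=> //= H; rewrite !ffunE /=.
  - by have [l il ->] := colP _ _ H; apply: cuP.
  - by have [l il ->] := colP _ _ H; rewrite eq_sym; apply: cuP.
  - by have [l il ->] := colP _ _ H; rewrite eq_sym; apply: ceP.
  - by have [l il ->] := colP _ _ H; apply: ceP.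
  - by case/andP: H => /eqP-> H; apply: cpP.
have vertexX (i : 'I_n) y : y \in vertex_nbrs ce i ->
    exists2 e : edge_of K, i \in val e & col e = y.
  case/mapP=> j; rewrite mem_enum inE => ji ->.
  have [|e eij <-] := colX i j; first by rewrite eq_sym.
  by exists e => //; rewrite eij !inE eqxx.
apply/forallP=> x; apply/existsP.
case: (bx x) => [[i ux sx]|[i [h [px sx]]]|[i [j [ij ex sx]]]].
- exists (inl (inl i)); rewrite ffunE ux eqxx; apply/forallP=> y.
  apply/implyP; rewrite ffunE /= ux => /sx/vertexX[e ie ey].
  by apply/existsP; exists (inl (inr e)); rewrite ffunE /= ie ey eqxx.
- exists (inr (i, h)); rewrite ffunE px eqxx; apply/forallP=> y.
  apply/implyP; rewrite ffunE /= px => /sx; rewrite mem_cat => /orP[].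
    case/vertexX=> e ie ey.
    by apply/existsP; exists (inl (inr e)); rewrite ffunE /= ie ey eqxx.
  case/mapP=> h'; rewrite mem_enum => hh' ->.
  by apply/existsP; exists (inr (i, h')); rewrite ffunE /= !eqxx; apply/andP.
have [e eij exE] := colX _ _ ij.
have ie : i \in val e by rewrite eij !inE eqxx.
have je : j \in val e by rewrite eij !inE eqxx orbT.
exists (inl (inr e)); rewrite ffunE exE ex eqxx; apply/forallP=> y.
apply/implyP; rewrite ffunE /= exE ex => /sx.
rewrite !inE mem_cat => /or4P[/eqP->|/eqP->|/codomP[h ->]|/codomP[h ->]];
  apply/existsP.
- by exists (inl (inl i)); rewrite ffunE /= ie eqxx.
- by exists (inl (inl j)); rewrite ffunE /= je eqxx.
- by exists (inr (i, h)); rewrite ffunE /= ie eqxx.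
- by exists (inr (j, h)); rewrite ffunE /= je eqxx.
Qed.

End Coordinates.

(** With colours in [nat], explicit colourings can be checked by [lia]. The b-vertices offered are
    those used below: copy vertices, and edge-vertices that see all other colours in the two copies
    alone. *)
Lemma b_colorable_of_nat n t k (cu : nat -> nat) (ce cp : nat -> nat -> nat) :
  (forall i, i < n -> cu i < k) ->
  (forall i j, i < n -> j < n -> ce i j < k) ->
  (forall i h, i < n -> h < t -> cp i h < k) ->
  (forall i j, i < n -> j < n -> ce i j = ce j i) ->
  (forall i j, i < n -> j < n -> i <> j -> cu i <> ce i j) ->
  (forall i j h, i < n -> j < n -> h < t -> i <> j -> cp i h <> ce i j) ->
  (forall i h, i < n -> h.+1 < t -> cp i h <> cp i h.+1) ->
  (forall x, x < k ->
    (exists i h, [/\ i < n, h < t, cp i h = x &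
       forall y, y < k -> y <> x ->
         (exists j, [/\ j < n, j <> i & ce i j = y]) \/
         (exists h', [/\ h' < t, h' = h.+1 \/ h = h'.+1 & cp i h' = y])])
    \/
    (exists i j, [/\ i < n, j < n, i <> j, ce i j = x &
       forall y, y < k -> y <> x ->
         exists2 h, h < t & cp i h = y \/ cp j h = y])) ->
  b_colorable (svn_corona (complete_graph n) (path_graph t)) k.
Proof.
move=> cuk cek cpk ceC cuP ceP cpP bP.
have ltI m (i : 'I_m) : i < m by exact: ltn_ord.
pose cu' (i : 'I_n) : 'I_k := Ordinal (cuk i (ltI _ i)).
pose ce' (i j : 'I_n) : 'I_k := Ordinal (cek i j (ltI _ i) (ltI _ j)).
pose cp' (i : 'I_n) (h : 'I_t) : 'I_k := Ordinal (cpk i h (ltI _ i) (ltI _ h)).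
have neqI m (i j : 'I_m) : i != j -> i <> j :> nat by move/eqP => ij /val_inj.
apply: (@b_colorable_of_coords n t k cu' ce' cp').
  split=> [i j|i j ij|i j h ij|i h h' hh'].
  - by apply: val_inj; apply: ceC.
  - by apply/eqP=> /(congr1 val); apply: cuP => //; apply: neqI.
  - by apply/eqP=> /(congr1 val); apply: ceP => //; apply: neqI.
  - apply/eqP=> /(congr1 val) /=; case/orP: hh' => /eqP E.
      by rewrite -E; apply: cpP; rewrite ?E.
    by move/esym; rewrite -E; apply: cpP; rewrite ?E.
move=> x; case: (bP x (ltI _ x)).
  case=> i [h [ni th ix sx]].
  constructor 2; exists (Ordinal ni), (Ordinal th); split; first exact: val_inj.
  move=> y /neqI yx; rewrite mem_cat.
  case: (sx y (ltI _ y) yx) => [[j [nj ji jy]]|[h' [th' hh' hy]]];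
      apply/orP; [left | right].
    apply/mapP; exists (Ordinal nj); last by apply: val_inj.
    by rewrite mem_enum inE -val_eqE; apply/eqP.
  apply/mapP; exists (Ordinal th'); last by apply: val_inj.
  rewrite mem_enum /in_mem /= /path_rel /=.
  by case: hh' => ->; rewrite eqxx ?orbT.
case=> i [j [ni nj ij ex sx]].
constructor 3; exists (Ordinal ni), (Ordinal nj); split.
- by rewrite -val_eqE; apply/eqP.
- exact: val_inj.
move=> y /neqI yx; have [h th hy] := sx y (ltI _ y) yx.
rewrite !inE mem_cat; case: hy => hy.
  have -> : y = cp' (Ordinal ni) (Ordinal th) by exact: val_inj.
  by rewrite (codom_f (cp' _)) !orbT.
have -> : y = cp' (Ordinal nj) (Ordinal th) by exact: val_inj.
by rewrite (codom_f (cp' _)) !orbT.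
Qed.

(** * Lower bounds: explicit colourings *)

Definition addm N a b := if a + b < N then a + b else a + b - N.

(** This is the periodic word abcabc...; with distinct letters, each inner vertex of a path so
    coloured sees the other two. *)
Definition cycle3 (a b c h : nat) := nth 0 [:: a; b; c] (h %% 3).

Lemma cycle3S a b c h : cycle3 a b c h.+1 = cycle3 b c a h.
Proof.
rewrite /cycle3; have : h.+1 %% 3 = if h %% 3 == 2 then 0 else (h %% 3).+1.
  by case: eqP; lia.
by have := ltn_pmod h (isT : 0 < 3); case: (h %% 3) => [|[|[|]]] // _ ->.
Qed.

Lemma cycle3P a b c h :
  cycle3 a b c h = a \/ cycle3 a b c h = b \/ cycle3 a b c h = c.
Proof.
rewrite /cycle3; have := ltn_pmod h (isT : 0 < 3).
by case: (h %% 3) => [|[|[|]]] // _; tauto.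
Qed.

Lemma cycle3_neqS a b c h :
  uniq [:: a; b; c] -> cycle3 a b c h <> cycle3 a b c h.+1.
Proof.
elim: h a b c => [|h IH] a b c abc.
  by rewrite /cycle3 /=; move: abc; rewrite /= !inE; lia.
by rewrite 2!cycle3S; apply: IH; move: abc; rewrite /= !inE; lia.
Qed.

Notation corona n t := (svn_corona (complete_graph n) (path_graph t)).

Lemma b_colorable_large n t :
  4 < n -> 3 < t -> b_colorable (corona n t) (n + 2).
Proof.
move=> n4 t3.
(* Identify u_i with the residue [v i] modulo n + 2; the residues 1 and -1 are
   left out.  The colours missing on the edges at v are 2v, v + 1 and v - 1. *)
pose v i := if i is 0 then 0 else i.+1.
pose ce i j := addm (n + 2) (v i) (v j).
pose cp i h := if i is 0 then cycle3 1 0 n.+1 h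
               else cycle3 (addm (n + 2) i.+1 i.+1) i.+2 i h.
pose cu i := (v i).+1.
(* The facts [vE] to [cpE] turn the colours into linear case distinctions for [lia]. *)
have vE i : (i = 0 /\ v i = 0) \/ (0 < i /\ v i = i.+1).
  by case: i => [|i]; [left | right].
have ceE i j : (v i + v j < n + 2 /\ ce i j = v i + v j) \/
               (n + 2 <= v i + v j /\ ce i j = v i + v j - (n + 2)).
  by rewrite /ce /addm; case: ltnP; [left | right].
have dE i : (i.+1 + i.+1 < n + 2 /\ addm (n + 2) i.+1 i.+1 = i.+1 + i.+1) \/
   (n + 2 <= i.+1 + i.+1 /\ addm (n + 2) i.+1 i.+1 = i.+1 + i.+1 - (n + 2)).
  by rewrite /addm; case: ltnP; [left | right].
have cpE i h : i = 0 /\ (cp i h = 1 \/ cp i h = 0 \/ cp i h = n.+1) \/ 0 < i /\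
    (cp i h = addm (n + 2) i.+1 i.+1 \/ cp i h = i.+2 \/ cp i h = i).
  by case: i => [|i]; [left | right]; split=> //; apply: cycle3P.
have surj i y : 0 < i -> i < n -> y < n + 2 -> y <> i -> y <> i.+2 ->
    y <> addm (n + 2) i.+1 i.+1 -> exists j, [/\ j < n, j <> i & ce i j = y].
  move=> i0 ni yn yi yi2 yd.
  (* Here w solves v_i + w = y modulo n + 2, and the excluded values of y are those with w = 1, w =
     -1 or w = v_i. *)
  pose w := if i.+1 <= y then y - i.+1 else y + (n + 2) - i.+1.
  have wE : (i.+1 <= y /\ w = y - i.+1) \/ (y < i.+1 /\ w = y + (n + 2) - i.+1).
    by rewrite /w; case: (leqP i.+1 y) => ?; lia.
  have w0 : w = 0 \/ 2 <= w <= n by have := dE i; lia.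
  case: w0 => w0.
    exists 0; have := ceE i 0; have := vE i; rewrite /=; split; lia.
  exists w.-1; have := ceE i w.-1; have := vE i; have := vE w.-1; have := dE i.
  split; lia.
apply: (@b_colorable_of_nat n t (n + 2) cu ce cp).
- move=> i ni; rewrite /cu; have := vE i; lia.
- move=> i j ni nj; have := vE i; have := vE j; have := ceE i j; lia.
- move=> i h ni th; have := cpE i h; have := dE i; lia.
- by move=> i j _ _; rewrite /ce /addm addnC.
- move=> i j ni nj ij; rewrite /cu; have := vE i; have := vE j; have := ceE i j.
  lia.
- move=> i j h ni nj th ij; have := vE i; have := vE j; have := ceE i j.
  have := cpE i h; have := dE i; lia.
- move=> [|i] h ni th; apply: cycle3_neqS => /=; rewrite !inE.
    lia.
  have := dE i.+1; lia.
move=> x xn; left; have [x0|x0] := eqVneq x 0.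
  exists 0, 1; split=> //; try lia.
  move=> y yn yx; case: (ltngtP y 1) => y1; first lia; last first.
    by right; exists 0; split; [lia | right | rewrite y1].
  have [yn1|yn1] := eqVneq y n.+1.
    by right; exists 2; split; [lia | left | rewrite yn1].
  left; exists y.-1; have := ceE 0 y.-1; have := vE 0; have := vE y.-1.
  split; lia.
(* For i > 0 the colours v + 1 start at 3. The colours 1 and 2 occur as v - 1 in the copies 1 and 2,
   at the vertex 2, which is an inner one because t > 3. *)
have [x2|x2] := leqP x 2.
  exists x, 2; split; [lia | lia | by case: x x0 {xn x2} |].
  move=> y yn yx.
  have [yd|yd] := eqVneq y (addm (n + 2) x.+1 x.+1).
    right; exists 3; split; [lia | by left |].
    by rewrite yd; case: x x0 {xn x2 yx yd}.
  have [yx2|yx2] := eqVneq y x.+2.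
    right; exists 1; split; [lia | by right |].
    by rewrite yx2; case: x x0 {xn x2 yx yd yx2}.
  left; apply: surj; lia.
case: x x0 xn x2 => [|[|[|x]]] // _ xn _.
exists x.+1, 1; split=> //; try lia.
move=> y yn yx.
have [yd|yd] := eqVneq y (addm (n + 2) x.+2 x.+2).
  by right; exists 0; split; [lia | right | rewrite yd].
have [yx1|yx1] := eqVneq y x.+1.
  by right; exists 2; split; [lia | left | rewrite yx1].
left; apply: surj; lia.
Qed.

Lemma b_colorable_P3 n : 4 < n -> b_colorable (corona n 3) (n + 1).
Proof.
move=> n4.
(* Here u_i is the residue v = i + 1 modulo n + 1, so only v and 2v are missing
   on the edges at v and 0 is missing nowhere.  Giving the edge {1, -1} the
   colour -2 instead of 0 frees 0 at both its ends and repeats a colour at 1. *)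
pose ce i j := if i + j.+1 == n then if (i == 0) || (j == 0) then n.-1 else
   addm (n + 1) i.+1 j.+1 else addm (n + 1) i.+1 j.+1.
pose cp i h := if i == 0 then h else if i.+1 == n then (if h == 1 then 0 else n)
               else if h == 1 then i.+1 else addm (n + 1) i.+1 i.+1.
have aE i j : (i.+1 + j.+1 < n + 1 /\ addm (n + 1) i.+1 j.+1 = i.+1 + j.+1) \/
   (n + 1 <= i.+1 + j.+1 /\ addm (n + 1) i.+1 j.+1 = i.+1 + j.+1 - (n + 1)).
  by rewrite /addm; case: ltnP; [left | right].
have ceE i j : (i = 0 /\ j.+1 = n /\ ce i j = n.-1) \/
    (j = 0 /\ i.+1 = n /\ ce i j = n.-1) \/
    (~ (i = 0 /\ j.+1 = n) /\ ~ (j = 0 /\ i.+1 = n) /\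
     ce i j = addm (n + 1) i.+1 j.+1).
  rewrite /ce; do !case: eqP => /=; move=> *;
  lia.
have cpE i h : (i = 0 /\ cp i h = h) \/
    (0 < i /\ i.+1 = n /\ h = 1 /\ cp i h = 0) \/
    (0 < i /\ i.+1 = n /\ h <> 1 /\ cp i h = n) \/
    (0 < i /\ i.+1 <> n /\ ((h = 1 /\ cp i h = i.+1) \/
       (h <> 1 /\ cp i h = addm (n + 1) i.+1 i.+1))).
  rewrite /cp; do !case: eqP => /=; move=> *;
  lia.
apply: (@b_colorable_of_nat n 3 (n + 1) succn ce cp).
- move=> i ni; lia.
- move=> i j ni nj; have := aE i j; have := ceE i j; lia.
- move=> i h ni th; have := cpE i h; have := aE i i; lia.
- move=> i j ni nj; have := ceE i j; have := ceE j i; have := aE i j.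
  have := aE j i; lia.
- move=> i j ni nj ij; have := ceE i j; have := aE i j; lia.
- move=> i j h ni nj th ij; have := ceE i j; have := aE i j.
  have := cpE i h; have := aE i i; lia.
- move=> i h ni th; have := cpE i h; have := cpE i h.+1; have := aE i i; lia.
(* At the residue -1 = n the colour n - 1 = 2v comes from the recoloured edge, so only 0 and n are
   missing. *)
have last y : 0 < y -> y < n ->
    exists j, [/\ j < n, j <> n.-1 & ce n.-1 j = y].
  move=> y0 yn; have [yn1|yn1] := eqVneq y n.-1.
    by exists 0; have := ceE n.-1 0; split; lia.
  by exists y; have := ceE n.-1 y; have := aE n.-1 y; split; lia.
(* In the copy at the residue n both the middle and an end are b-vertices: they supply 0 and n to
   each other. *)
move=> x xn; left; have [x0|x0] := eqVneq x 0.
  exists n.-1, 1; split; try lia; first by have := cpE n.-1 1; lia.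
  move=> y yn yx; have [yn1|yn1] := eqVneq y n.
    by right; exists 0; split; [lia | right | have := cpE n.-1 0; lia].
  left; apply: last; lia.
have [xn1|xn1] := eqVneq x n.
  exists n.-1, 0; split; try lia; first by have := cpE n.-1 0; lia.
  move=> y yn yx; have [y0|y0] := eqVneq y 0.
    by right; exists 1; split; [lia | left | have := cpE n.-1 1; lia].
  left; apply: last; lia.
have [x1|x1] := eqVneq x 1.
  exists 0, 1; split; try lia; first by have := cpE 0 1; lia.
  move=> y yn yx; have [y0|y0] := eqVneq y 0.
    by right; exists 0; split; [lia | right | have := cpE 0 0; lia].
  have [y2|y2] := eqVneq y 2.
    by right; exists 2; split; [lia | left | have := cpE 0 2; lia].
  left; exists y.-2; have := ceE 0 y.-2; have := aE 0 y.-2; split; lia.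
exists x.-1, 1; split; try lia; first by have := cpE x.-1 1; lia.
move=> y yn yx; have [yd|yd] := eqVneq y (addm (n + 1) x x).
  right; exists 0; split; [lia | by right |].
  have := cpE x.-1 0; rewrite prednK; lia.
left; have E : x = x.-1.+1 by lia.
rewrite E in yd; have := aE x.-1 x.-1.
(* The witness j solves x + (j + 1) = y modulo n + 1. *)
have [xy|xy] := leqP x y.
  exists (y - x).-1; have := ceE x.-1 (y - x).-1; have := aE x.-1 (y - x).-1.
  split; lia.
exists (y + n - x); have := ceE x.-1 (y + n - x).
have := aE x.-1 (y + n - x); split; lia.
Qed.

Lemma b_colorable_K2_P3 : b_colorable (corona 2 3) 3.
Proof.
pose cp (i h : nat) := if h == 1 then 2 else 1.
have cpE i h : (h = 1 /\ cp i h = 2) \/ (h <> 1 /\ cp i h = 1).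
  by rewrite /cp; case: eqP; lia.
apply: (@b_colorable_of_nat 2 3 3 (fun=> 1) (fun _ _ => 0) cp) => //.
- by move=> i h _ _; have := cpE i h; lia.
- by move=> i j h _ _ _ _; have := cpE i h; lia.
- by move=> i h _ h2; have := cpE i h; have := cpE i h.+1; lia.
case=> [|[|[|]]] // _.
- right; exists 0, 1; split=> // y y3 y0; exists (if y == 1 then 0 else 1).
    by case: ifP.
  by move: y y3 y0 => [|[|[|]]] //; left.
- left; exists 0, 0; split=> // -[|[|[|]]] // _ _; first by left; exists 1.
  by right; exists 1; split=> //; left.
left; exists 0, 1; split=> // -[|[|[|]]] // _ _; first by left; exists 1.
by right; exists 0; split=> //; right.
Qed.

(** The edge-vertex, coloured 0, is adjacent to all other vertices. For t = 4 a copy has only two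
    inner vertices, so the colours 1, 2, 3 need both copies, with shifted words. *)
Lemma b_colorable_K2 t : 3 < t -> b_colorable (corona 2 t) 4.
Proof.
move=> t3; pose cp i h := if i is 0 then cycle3 1 2 3 h else cycle3 3 1 2 h.
have cpE i h : cp i h = 1 \/ cp i h = 2 \/ cp i h = 3.
  case: i => [|i] /=; first exact: cycle3P.
  have := cycle3P 3 1 2 h; rewrite /cp; lia.
apply: (@b_colorable_of_nat 2 t 4 (fun=> 1) (fun _ _ => 0) cp) => //.
- by move=> i h _ _; have := cpE i h; lia.
- by move=> i j h _ _ _ _; have := cpE i h; lia.
- by move=> [|i] h _ _; apply: cycle3_neqS.
case=> [|[|[|[|]]]] // _.
- right; exists 0, 1; split=> // -[|y] // y3 _; exists y; first lia.
  by move: y y3 => [|[|[|]]] //; left.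
- left; exists 1, 1; split=> //; first lia.
  move=> [|[|[|[|]]]] // _ _; first by left; exists 0.
    by right; exists 2; split; [lia | left |].
  by right; exists 0; split; [lia | right |].
- left; exists 0, 1; split=> //; first lia.
  move=> [|[|[|[|]]]] // _ _; first by left; exists 1.
    by right; exists 0; split; [lia | right |].
  by right; exists 2; split; [lia | left |].
- left; exists 0, 2; split=> //; first lia.
  move=> [|[|[|[|]]]] // _ _; first by left; exists 1.
    by right; exists 3; split; [lia | left |].
  by right; exists 1; split; [lia | right |].
Qed.

(** The copy at u_i gets 3, 4 and the colour 2 - i of the edge opposite to u_i, so every edge-vertex
    is a b-vertex. The copy at u_1 exchanges 3 and 4, so that the second vertices of the copies 0
    and 1 serve 3 and 4. *)
Lemma b_colorable_K3 t : 2 < t -> b_colorable (corona 3 t) 5.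
Proof.
move=> t2.
pose cp i h := if i is i'.+1 then if i' is 0 then cycle3 1 4 3 h
                 else cycle3 0 3 4 h else cycle3 2 3 4 h.
have cpE i h : i < 3 -> (cp i h = 3 \/ cp i h = 4 \/ cp i h = 2 - i) /\
    uniq [:: cp i h; cp i h.+1].
  case: i => [|[|[|]]] // _; rewrite /cp cycle3S /=;
  by rewrite /cycle3; have := ltn_pmod h (isT : 0 < 3);
     case: (h %% 3) => [|[|[|]]] // _; split=> //; tauto.
apply: (@b_colorable_of_nat 3 t 5 (fun=> 3) (fun i j => (i + j).-1) cp) => //.
- by move=> i j; lia.
- by move=> i h i3 _; have := cpE i h i3; lia.
- by move=> i j; rewrite addnC.
- by move=> i j; lia.
- by move=> i j h i3 j3 _ ij; have := cpE i h i3; lia.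
- by move=> i h i3 _; have [_] := cpE i h i3; rewrite /= inE; lia.
case=> [|[|[|[|[|]]]]] // _.
- right; exists 0, 1; split=> // -[|[|[|[|[|]]]]] // _ _.
  + by exists 0; [lia | right].
  + by exists 0; [lia | left].
  + by exists 1; [lia | left].
  + by exists 2; [lia | left].
- right; exists 0, 2; split=> // -[|[|[|[|[|]]]]] // _ _.
  + by exists 0; [lia | right].
  + by exists 0; [lia | left].
  + by exists 1; [lia | left].
  + by exists 2; [lia | left].
- right; exists 1, 2; split=> // -[|[|[|[|[|]]]]] // _ _.
  + by exists 0; [lia | right].
  + by exists 0; [lia | left].
  + by exists 1; [lia | right].
  + by exists 1; [lia | left].
- left; exists 0, 1; split=> //; first lia.
  move=> [|[|[|[|[|]]]]] // _ _.
  + by left; exists 1.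
  + by left; exists 2.
  + by right; exists 0; split; [lia | right |].
  + by right; exists 2; split; [lia | left |].
- left; exists 1, 1; split=> //; first lia.
  move=> [|[|[|[|[|]]]]] // _ _.
  + by left; exists 0.
  + by right; exists 0; split; [lia | right |].
  + by left; exists 2.
  + by right; exists 2; split; [lia | left |].
Qed.

Lemma b_colorable_K4 t : 2 < t -> b_colorable (corona 4 t) 6.
Proof.
move=> t2.
(* The six edges get different colours, and the copy at u_i gets the colours of
   the triangle opposite to u_i; all the edge-vertices are then b-vertices. *)
pose tri i := nth [::]
  [:: [:: 3; 4; 5]; [:: 1; 2; 5]; [:: 0; 2; 4]; [:: 0; 1; 3]] i.
pose cp i h := nth 0 (tri i) (h %% 3).
pose ce i j := nth 0 (nth [::] [:: [:: 0; 0; 1; 2]; [:: 0; 0; 3; 4];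
  [:: 1; 3; 0; 5]; [:: 2; 4; 5; 0]] i) j.
have mod3 h : h %% 3 < 3 by rewrite ltn_pmod.
(* An edge other than ij avoids i or j, hence lies in the triangle opposite to one of them. *)
have edge i j : i < 4 -> j < 4 -> i <> j -> forall y, y < 6 -> y <> ce i j ->
    exists2 h, h < t & cp i h = y \/ cp j h = y.
  move=> i4 j4 ij y y6 yx.
  pose P h := (nth 0 (tri i) h == y) || (nth 0 (tri j) h == y).
  suff /hasP[h] : has P (iota 0 3).
    rewrite mem_iota => /andP[_ h3] hy; exists h; first lia.
    by rewrite /cp modn_small //; case/orP: hy => /eqP; [left | right].
  rewrite /P {P}.
  by move: i i4 ij yx => [|[|[|[|]]]] // _; move: j j4 => [|[|[|[|]]]] // _ //;
     move: y y6 => [|[|[|[|[|[|]]]]]] // _.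
have cpU i a b : i < 4 -> a < 3 -> b < 3 -> a <> b ->
    nth 0 (tri i) a <> nth 0 (tri i) b.
  by move: i a b => [|[|[|[|]]]] // [|[|[|]]] // [|[|[|]]].
have ceU i j a : i < 4 -> j < 4 -> a < 3 -> i <> j ->
    nth 0 (tri i) a <> ce i j.
  by move: i j a => [|[|[|[|]]]] // [|[|[|[|]]]] // [|[|[|]]].
apply: (@b_colorable_of_nat 4 t 6 (fun i => cp i 0) ce cp).
- by move=> [|[|[|[|]]]].
- by move=> [|[|[|[|]]]] // [|[|[|[|]]]].
- move=> i h i4 _; rewrite /cp; move: (h %% 3) (mod3 h) i i4.
  by move=> [|[|[|]]] // _ [|[|[|[|]]]].
- by move=> [|[|[|[|]]]] // [|[|[|[|]]]].
- by move=> i j i4 j4 ij; apply: ceU.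
- by move=> i j h i4 j4 _ ij; apply: ceU.
- by move=> i h i4 _; apply: cpU => //; lia.
move=> x x6; right.
suff [i [j [i4 j4 ij <-]]] : exists i j, [/\ i < 4, j < 4, i <> j & ce i j = x].
  by exists i, j; split=> //; apply: edge.
by move: x x6 => [|[|[|[|[|[|]]]]]] // _;
  [exists 0, 1 | exists 0, 2 | exists 0, 3 | exists 1, 2 | exists 1, 3
  | exists 2, 3].
Qed.

(** * Upper bound n + 2: degrees and number of edges *)

Lemma leq_size_predC1 k (x : 'I_k) (s : seq 'I_k) :
  {subset predC1 x <= s} -> k <= (size s).+1.
Proof.
move=> sub; have full : 'I_k =i x :: s.
  move=> y; rewrite !inE; have [//|yx] := eqVneq y x.
  by rewrite (sub y).
by apply: leq_trans (card_size (x :: s)); rewrite -(eq_card full) card_ord.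
Qed.

Lemma size_vertex_nbrs n k (ce : 'I_n -> 'I_n -> 'I_k) i :
  size (vertex_nbrs ce i) = n.-1.
Proof. by rewrite size_map -cardE cardC1 card_ord. Qed.

Lemma card_path_rel t (h : 'I_t) : #|path_rel h| <= 2.
Proof.
rewrite cardE -(size_map val).
apply: (@leq_trans (size [:: h.+1; h.-1])) => //.
apply: uniq_leq_size.
  by rewrite map_inj_uniq ?enum_uniq //; apply: val_inj.
move=> y /mapP[h']; rewrite mem_enum => hh' ->; rewrite !inE /=.
by case/orP: hh' => /eqP <- /=; rewrite eqxx ?orbT.
Qed.

Lemma size_copy_nbrs n t k ce (cp : 'I_n -> 'I_t -> 'I_k) i h :
  size (copy_nbrs ce cp i h) = n.-1 + #|path_rel h|.
Proof. by rewrite size_cat size_vertex_nbrs size_map -cardE. Qed.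

Lemma size_edge_nbrs n t k (cu : 'I_n -> 'I_k) (cp : 'I_n -> 'I_t -> 'I_k) i j :
  size (edge_nbrs cu cp i j) = (2 * t).+2.
Proof. by rewrite /= size_cat !size_codom card_ord mul2n addnn. Qed.

(** The vertices u_i and those of the copies have degree at most n + 1 < k - 1. *)
Lemma b_coords_edge n t k (cu : 'I_n -> 'I_k) ce (cp : 'I_n -> 'I_t -> 'I_k) x :
  0 < n -> n + 2 < k -> b_coords cu ce cp x ->
  k <= (2 * t).+3 /\ exists2 p : 'I_n * 'I_n, p.1 != p.2 & ce p.1 p.2 = x.
Proof.
move=> n0 nk [[i _ /leq_size_predC1]|[i [h [_ /leq_size_predC1]]]|].
- by rewrite size_vertex_nbrs; lia.
- by rewrite size_copy_nbrs; have := card_path_rel h; lia.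
move=> [i [j [ij <- /leq_size_predC1]]]; rewrite size_edge_nbrs => kt.
by split=> //; exists (i, j).
Qed.

Lemma leq_card_edges n k (ce : 'I_n -> 'I_n -> 'I_k) :
  (forall i j, ce i j = ce j i) ->
  (forall x, exists2 p : 'I_n * 'I_n, p.1 != p.2 & ce p.1 p.2 = x) ->
  k <= 'C(n, 2).
Proof.
move=> ceC surj.
pose D := [set A : {set 'I_n} | #|A| == 2].
have -> : 'C(n, 2) = #|D| by rewrite card_draws card_ord.
(* Choosing an edge of each colour embeds the colours into the 2-subsets; injectivity uses the
   symmetry of [ce]. *)
have [r rP] : exists r : 'I_k -> 'I_n * 'I_n,
    forall x, ((r x).1 != (r x).2) /\ ce (r x).1 (r x).2 = x.
  have [x|r rP] := @fin_all_exists _ (fun=> ('I_n * 'I_n)%type)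
    (fun x p => (p.1 != p.2) /\ ce p.1 p.2 = x); last by exists r.
  by have [p] := surj x; exists p.
pose E x := [set (r x).1; (r x).2].
have Einj : injective E.
  move=> x y /setP E12; have [nx ex] := rP x; have [ny ey] := rP y.
  have := E12 (r x).1; have := E12 (r x).2; rewrite !inE !eqxx orbT /=.
  case/esym/orP=> /eqP E2 /esym/orP[]/eqP E1; rewrite -ex -ey E1 E2 //.
  - by rewrite E1 E2 eqxx in nx.
  - by rewrite E1 E2 eqxx in nx.
rewrite -[k in k <= _]card_ord -(card_imset predT Einj).
apply: subset_leq_card; apply/subsetP=> _ /imsetP[x _ ->].
by rewrite inE cards2 (rP x).1.
Qed.

(** More than n + 2 colours would force both k <= 'C(n, 2) and k <= 2t + 3; each alternative of the
    hypothesis excludes one of these. *)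
Lemma b_colorable_leq n t k : 0 < n -> 'C(n, 2) < n + 3 \/ 2 * t + 1 <= n ->
  b_colorable (corona n t) k -> k <= n + 2.
Proof.
move=> n0 H /coords_of_b_coloring[cu [ce [cp [[ceC _ _ _] bP]]]].
rewrite leqNgt; apply/negP=> kn.
have {}bP x := b_coords_edge n0 kn (bP x).
have kt : k <= (2 * t).+3.
  by have [] := bP (Ordinal (leq_ltn_trans (leq0n _) kn)).
have := leq_card_edges ceC (fun x => (bP x).2).
lia.
Qed.

Lemma b_chromatic_number_eq (G : sgraph) m : b_colorable G m ->
  (forall k, b_colorable G k -> k <= m) -> b_chromatic_number G = m.
Proof.
move=> mG le; apply/eqP; rewrite eqn_leq b_colorable_le // andbT.
by apply/bigmax_leqP=> k; apply: le.
Qed.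

(** * A rank argument over the rationals *)

Section RankBound.
Local Open Scope ring_scope.
Import GRing.Theory Num.Theory.

(* Each index x carries a point or a pair of [m] points.  A vanishing linear
   combination v of their indicator vectors is zero at the points; pairing it
   with the indicator of [S ^~ y] for a pair y gives [v y = \sum_x v x], so v is
   constant on the pairs, and zero as soon as there are two of them. *)
Lemma rank_bound (N m : nat) (r : 'I_N -> 'I_m + 'I_m * 'I_m)
    (S : 'I_m -> pred 'I_N) :
  (forall x y l, r x = inl l -> r y = inl l -> x = y) ->
  (forall x y l i j, r x = inl l -> r y = inr (i, j) -> (l != i) && (l != j)) ->
  (forall x i j, r x = inr (i, j) ->
     forall y, (S i y + S j y)%N = (y != x) :> nat) ->
  (N <= m.+1)%N.
Proof.
move=> inj disj SP; rewrite leqNgt; apply/negP=> mN.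
(* [F f x] pairs f with the indicator vector of the index x; these vectors are the rows of [B]. *)
pose F (f : 'I_m -> rat) x :=
  match r x with inl l => f l | inr (i, j) => f i + f j end.
pose B : 'M[rat]_(N, m) := \matrix_(x, i) F (fun l => (l == i)%:R) x.
have : kermx B != 0.
  rewrite kermx_eq0 /row_free neq_ltn; apply/orP; left.
  by apply: leq_ltn_trans (rank_leq_col B) _; apply: ltnW.
case/rowV0Pn=> v /sub_kermxP vB /eqP[]; apply/rowP=> x; rewrite mxE.
(* [F f] is [B] applied to the column f, and v lies in the left kernel of [B]. *)
have key f : \sum_x v 0 x * F f x = 0.
  have FE x' : F f x' = \sum_i B x' i * f i.
    rewrite /F; under eq_bigr do rewrite mxE /F.
    have one l : \sum_i (l == i)%:R * f i = f l.
      rewrite (bigD1 l) //= eqxx mul1r big1 ?addr0 // => i.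
      by rewrite eq_sym => /negPf->; rewrite mul0r.
    case: (r x') => [l|[i j]]; first by rewrite one.
    by under eq_bigr do rewrite mulrDl; rewrite big_split /= !one.
  under eq_bigr => x' _ do rewrite FE mulr_sumr.
  rewrite exchange_big big1 //= => i _.
  under eq_bigr => x' _ do rewrite mulrA.
  rewrite -mulr_suml; have := congr1 (fun M : 'rV_m => M 0 i) vB.
  by rewrite !mxE => ->; rewrite mul0r.
have v_inl y l : r y = inl l -> v 0 y = 0.
  move=> ry; rewrite -[RHS](key (fun i => (i == l)%:R)) (bigD1 y) //=.
  rewrite {1}/F ry eqxx mulr1 big1 ?addr0 // => z zy.
  rewrite /F; case rz : (r z) => [l'|[i j]].
    have [ll'|] := eqVneq l' l; last by rewrite mulr0.
    by rewrite (inj z y l) ?eqxx // ?rz ?ll' // in zy.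
  have /andP[] := disj _ _ _ _ _ ry rz.
  by rewrite 2!(eq_sym l) => /negPf-> /negPf->; rewrite addr0 mulr0.
set s := \sum_y v 0 y.
have v_inr y p : r y = inr p -> v 0 y = s.
  case: p => i j ry; apply/esym/eqP; rewrite -subr_eq0 /s (bigD1 y) //=.
  rewrite addrAC subrr add0r -[X in _ == X](key (fun l => (S l y)%:R)).
  rewrite [X in _ == X](bigD1 y) //=.
  rewrite {1}/F ry -natrD (SP _ _ _ ry) eqxx mulr0 add0r.
  apply/eqP; apply: eq_bigr => z zy; rewrite /F.
  case rz : (r z) => [l|[a b]]; first by rewrite (v_inl _ _ rz) mul0r.
  by rewrite -natrD (SP _ _ _ rz) eq_sym zy mulr1.
pose X := [set y | if r y is inr _ then true else false].
suff s0 : s = 0.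
  by case rx : (r x) => [l|p]; [apply: v_inl rx | rewrite (v_inr _ _ rx)].
(* Since v is s on the pairs and 0 at the points, two pairs suffice to make s vanish. *)
have sX : s = #|X|%:R * s.
  rewrite {1}/s (bigID (mem X)) /= [X in _ + X]big1 => [|y].
    rewrite addr0 mulr_natl -sumr_const; apply: eq_bigr => y.
    by rewrite inE; case ry : (r y) => [//|p] _; apply: v_inr ry.
  by rewrite inE; case ry : (r y) => [l|//] _; apply: v_inl ry.
(* Distinct indices carry distinct points, so at most m of the N > m + 1 indices carry one. *)
have X1 : (1 < #|X|)%N.
  pose h y := if r y is inl l then Some l else None.
  have hinj : {in ~: X &, injective h}.
    move=> y z; rewrite !inE /h; case ry : (r y) => [l|//] _.
    by case rz : (r z) => [l'|//] _ [ll']; apply: inj ry _; rewrite rz ll'.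
  have : (#|~: X| <= m)%N.
    rewrite -(card_in_imset hinj) -[m in (_ <= m)%N]card_ord.
    apply: leq_trans (leq_imset_card Some 'I_m); apply: subset_leq_card.
    apply/subsetP=> _ /imsetP[y yX ->]; move: yX; rewrite !inE /h /=.
    by case: (r y) => [l|//] _; apply/imsetP; exists l.
  have := cardsC X; rewrite card_ord; lia.
move/eqP: sX; rewrite -subr_eq0 -{1}[s]mul1r -mulrBl mulf_eq0 subr_eq0.
by rewrite -[1]/(1%:R) eqr_nat ltn_eqF //= => /eqP.
Qed.

End RankBound.

(** * Upper bound n + 1 for t = 3 *)

Definition mid : 'I_3 := @Ordinal 3 1 isT.

Lemma card_path_rel3 (h : 'I_3) : 1 < #|path_rel h| -> h = mid.
Proof.
move=> hc; apply/eqP; apply: contraLR hc => hm; rewrite -leqNgt.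
apply: (@leq_trans #|pred1 mid|); last by rewrite card1.
apply: subset_leq_card; apply/subsetP=> h' /orP hh'.
rewrite inE; apply/eqP/val_inj; move: hm hh'; rewrite -val_eqE /=.
by have := ltn_ord h; have := ltn_ord h'; lia.
Qed.

(** A b-vertex now needs degree n + 1. In a copy this forces two neighbours on the path, and an
    edge-vertex has degree 8. *)
Lemma b_coords_P3 n (cu : 'I_n -> 'I_(n + 2)) ce (cp : 'I_n -> 'I_3 -> _) x :
  b_coords cu ce cp x ->
  (exists2 i, cp i mid = x & {subset predC1 x <= copy_nbrs ce cp i mid}) \/
  n <= 7 /\ exists i j,
    [/\ i != j, ce i j = x & {subset predC1 x <= edge_nbrs cu cp i j}].
Proof.
case=> [[i _ /leq_size_predC1]|[i [h [ix sx]]]|].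
- by rewrite size_vertex_nbrs; lia.
- have := leq_size_predC1 sx; rewrite size_copy_nbrs => le.
  have hm : h = mid by apply: card_path_rel3; have := ltn_ord i; lia.
  by left; exists i; rewrite -hm.
move=> [i [j [ij ex sx]]]; right; split; last by exists i, j.
by have := leq_size_predC1 sx; rewrite size_edge_nbrs; lia.
Qed.

(** The candidates are two midpoints and one edge-vertex, too few for four colours. *)
Lemma not_b_colorable_K2_P3 : ~~ b_colorable (corona 2 3) 4.
Proof.
apply/negP=> /(@coords_of_b_coloring 2 3 (2 + 2)).
case=> cu [ce [cp [[ceC _ _ _] bP]]].
suff : 4 <= size [:: cp ord0 mid; cp ord_max mid; ce ord0 ord_max] by [].
apply: leq_trans (_ : size (enum 'I_4) <= _); first by rewrite size_enum_ord.
apply: uniq_leq_size; first exact: enum_uniq.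
move=> x _; have I2 (i : 'I_2) : i = ord0 \/ i = ord_max.
  by case: i => [[|[|]]] // ?; [left | right]; apply: val_inj.
case: (b_coords_P3 (bP x)) => [[i <- _]|[_ [i [j [ij <- _]]]]].
  by case: (I2 i) => ->; rewrite !inE eqxx ?orbT.
case: (I2 i) ij => ->; case: (I2 j) => -> // _; last rewrite ceC.
  by rewrite !inE eqxx !orbT.
by rewrite !inE eqxx !orbT.
Qed.

Lemma not_b_colorable_K7_P3 : ~~ b_colorable (corona 7 3) 9.
Proof.
apply/negP=> /(@coords_of_b_coloring 7 3 (7 + 2)).
case=> cu [ce [cp [[ceC cuP ceP _] bP]]].
pose A i := cu i :: codom (cp i).
have edgeP i j x : ce i j = x -> {subset predC1 x <= edge_nbrs cu cp i j} ->
    [/\ uniq (A i), uniq (A j)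
      & forall y, (y \in A i) + (y \in A j) = (y != x)].
  move=> ex sx; have full y : y \in x :: A i ++ A j.
    rewrite inE; have [//|yx] := eqVneq y x.
    have := sx y yx; rewrite !(inE, mem_cat).
    by case/or4P=> ->; rewrite ?orbT.
  (* The list has nine entries and covers all nine colours. *)
  have : uniq (x :: A i ++ A j).
    apply: (@leq_size_uniq _ (enum 'I_9)); rewrite ?enum_uniq //.
    by rewrite size_enum_ord /= size_cat /= !size_codom card_ord.
  rewrite cons_uniq cat_uniq mem_cat negb_or.
  case/andP=> /andP[xi xj] /and3P[ui dis uj].
  split=> // y; have [->|yx] := eqVneq y x.
    by rewrite (negPf xi) (negPf xj).
  have := full y; rewrite inE mem_cat (negPf yx) /=.
  case yj : (y \in A j); last by rewrite orbF => ->.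
  by have /hasPn/(_ y yj)/negPf-> := dis.
(* The midpoint has or sees the colour of u_i. No edge at u_i carries that colour, so it recurs in
   the copy. *)
have midP i :
    {subset predC1 (cp i mid) <= copy_nbrs ce cp i mid} -> ~~ uniq (A i).
  move=> sx; rewrite /= negb_and negbK; apply/orP; left.
  have [->|/sx] := eqVneq (cu i) (cp i mid); first exact: codom_f.
  rewrite mem_cat => /orP[] /mapP[j].
    by rewrite mem_enum inE eq_sym => /cuP/eqP.
  by move=> _ ->; apply: codom_f.
pose Q x (r : 'I_7 + 'I_7 * 'I_7) := match r with
  | inl i => cp i mid = x /\ {subset predC1 x <= copy_nbrs ce cp i mid}
  | inr (i, j) => ce i j = x /\ {subset predC1 x <= edge_nbrs cu cp i j} end.
have [x|r rP] := @fin_all_exists _ (fun=> ('I_7 + 'I_7 * 'I_7)%type) Q.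
  case: (b_coords_P3 (bP x)) => [[i ix sx]|[_ [i [j [ij ex sx]]]]].
    by exists (inl i).
  by exists (inr (i, j)).
(* The points are the seven copies: a midpoint carries its copy, an edge-vertex the pair of its
   ends. Disjointness holds because [midP] contradicts the [uniq] of [edgeP]. *)
suff : 7 + 2 <= 8 by [].
apply: (@rank_bound 9 7 r (fun i y => y \in A i)).
- move=> x y l rx ry; have := rP x; have := rP y.
  by rewrite rx ry => -[<- _] [<- _].
- move=> x y l i j rx ry; have := rP x; have := rP y; rewrite rx ry /=.
  move=> [ey /(edgeP _ _ _ ey)[ui uj _]] [lx]; rewrite -lx => /midP lu.
  by apply/andP; split; apply: contraNneq lu => ->.
- by move=> x i j rx; have := rP x; rewrite rx => -[ex /(edgeP _ _ _ ex)[]].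
Qed.

Lemma not_b_colorable_P3 n :
  n = 2 \/ 7 <= n -> ~~ b_colorable (corona n 3) (n + 2).
Proof.
case=> [->|]; first exact: not_b_colorable_K2_P3.
rewrite leq_eqVlt => /orP[/eqP<-|n7]; first exact: not_b_colorable_K7_P3.
(* For n > 7 only the n midpoints remain, for n + 2 colours. *)
apply/negP=> /coords_of_b_coloring[cu [ce [cp [_ bP]]]].
suff : n + 2 <= n by lia.
apply: (@leq_trans (size (enum 'I_(n + 2)))); first by rewrite size_enum_ord.
apply: (@leq_trans (size (codom (cp^~ mid)))); last first.
  by rewrite size_codom card_ord.
apply: uniq_leq_size; first exact: enum_uniq.
move=> x _; case: (b_coords_P3 (bP x)) => [[i <- _]|[n7' _]]; last lia.
exact: (codom_f (cp^~ mid)).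
Qed.

(** * Values of the b-chromatic number *)

Theorem theorem20 (n t : nat) (hn : 1 < n) (ht : 2 < t) :
  ((n = 2 /\ t = 3) \/ (7 <= n /\ t = 3) ->
     b_chromatic_number (svn_corona (complete_graph n) (path_graph t)) = n + 1)
  /\
  ((n = 2 /\ 3 < t) \/ (n = 3 \/ n = 4) \/ (2 * t + 1 <= n /\ 7 < 2 * t + 1) ->
     b_chromatic_number (svn_corona (complete_graph n) (path_graph t)) = n + 2).
Proof.
have n0 : 0 < n by exact: ltnW.
split=> [H|H]; apply: b_chromatic_number_eq.
- case: H => [[-> ->]|[n7 ->]]; first exact: b_colorable_K2_P3.
  by apply: b_colorable_P3; lia.
- have [n27 ->] : (n = 2 \/ 7 <= n) /\ t = 3 by lia.
  move=> k kb; have : k <= n + 2.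
    by apply: b_colorable_leq kb => //; case: n27 => [->|]; [left | right; lia].
  rewrite leq_eqVlt => /orP[/eqP kn|]; last by lia.
  by move: kb; rewrite kn (negPf (not_b_colorable_P3 n27)).
- case: H => [[-> t3]|[[]->|[n2t t7]]].
  + exact: b_colorable_K2.
  + exact: b_colorable_K3.
  + exact: b_colorable_K4.
  (* Here 7 < 2t + 1 gives t > 3, and then n > 4. *)
  + by apply: b_colorable_large; lia.
- move=> k; apply: b_colorable_leq => //.
  by case: H => [[-> _]|[[]->|[n2t _]]]; [left | left | left | right].
Qed.
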